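(* For every integer $n\geq 0$, \[ \overline{p}(5^{2}n)\equiv \overline{p}(5^{4}n) \pmod{5}. \]
   Context: An overpartition of a nonnegative integer $n$ is a partition of $n$ in which the first occurrence of each distinct part may be overlined. $\overline{p}(n)$ denotes the number of overpartitions of $n$, with $\overline{p}(0)=1$; equivalently $\sum_{n\ge0}\overline{p}(n)q^n=\prod_{k\ge1}\frac{1+q^k}{1-q^k}$. *)

(* Defs.v *)
From mathcomp Require Import all_boot.
Set Implicit Arguments. Unset Strict Implicit. Unset Printing Implicit Defensive.

(* An overpartition of n is represented as a sequence of entries (part, overlined),
   listing the parts of a partition of n in nonincreasing order; an entry may be
   overlined only if it is the first occurrence of its part value (i.e. the
   previous entry, if any, has a different part). *)

Definition op_parts (s : seq (nat * bool)) : seq nat := map fst s.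

Fixpoint op_first_only (prev : option nat) (s : seq (nat * bool)) : bool :=
  match s with
  | [::] => true
  | (a, b) :: s' => (b ==> (prev != Some a)) && op_first_only (Some a) s'
  end.

Definition is_overpartition (n : nat) (s : seq (nat * bool)) : bool :=
  [&& all (fun a => 0 < a) (op_parts s),
      sorted geq (op_parts s),
      sumn (op_parts s) == n &
      op_first_only None s].

(* Every overpartition of n has at most n parts, each at most n, so all of
   them are among the bounded sequences n.-bseq ('I_n.+1 * bool). *)
Definition to_op n (s : n.-bseq ('I_n.+1 * bool)) : seq (nat * bool) :=
  map (fun x => (nat_of_ord x.1, x.2)) s.

Definition pbar (n : nat) : nat :=
  #|[pred s : n.-bseq ('I_n.+1 * bool) | is_overpartition n (to_op s)]|.

(* Main.v *)
(** Let phi = sum_j (-1)^j q^(j^2), so that sum_n pbar(n) q^n = 1/phi (Gauss).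
    Modulo 5, phi^5 = phi(q^5), hence (sum_n pbar(n) q^n) phi(q^5) = phi^4.
    Writing r_k(n) for the number of representations of n as a sum of k squares,
    the coefficient of q^n in phi^k is (-1)^n r_k(n).  Extracting the exponents
    divisible by 5 and using r_4(5n) = r_4(n) mod 5 gives
    sum_n pbar(5n) q^n = phi^3, that is pbar(5n) = (-1)^n r_3(n) mod 5.  It then
    remains to see that r_3(125n) = r_3(5n) mod 5.

    Both congruences for r_k come from the six quaternions 1 + u of norm 5,
    u = 2i, -2i, 2j, -2j, 2k, -2k: the maps y |-> (1+u) y on quaternions and
    y |-> (1+u) y (1-u) on pure quaternions multiply the norm by 5 and 25, and
    each x of the target norm lies in the image of exactly 1 or 6 of them. *)
From Stdlib Require Import ZArith.
Require Import Defs.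
From mathcomp Require Import all_boot zify ssrZ.
Set Implicit Arguments. Unset Strict Implicit. Unset Printing Implicit Defensive.

(** * Overpartitions with bounded parts *)

(* [free] tells whether the first occurrence of the part [m] may be overlined. *)
Definition bounded_op (m : nat) (free : bool) (n : nat) (s : seq (nat * bool)) :=
  [&& all (fun a => 0 < a) (op_parts s), path geq m (op_parts s),
      sumn (op_parts s) == n &
      op_first_only (if free then None else Some m) s].

(* [f] is fuel; the enumeration is complete as soon as [m + n <= f]. *)
Fixpoint ovs (f m : nat) (free : bool) (n : nat) : seq (seq (nat * bool)) :=
  match f, m with
  | f'.+1, m'.+1 =>
      let L := if m <= n then ovs f' m false (n - m) else [::] in
      ovs f' m' true n ++ map (cons (m, false)) L
        ++ (if free then map (cons (m, true)) L else [::])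
  | _, _ => if n == 0 then [:: [::]] else [::]
  end.

Lemma bounded_op0 (free : bool) (n : nat) s :
  bounded_op 0 free n s = (n == 0) && (s == [::]).
Proof.
case: s => [|[a b] s]; rewrite /bounded_op /= ?andbT 1?eq_sym // andbF.
by case: a => //=; rewrite ?andbF.
Qed.

(** Removing a first part [m.+1] leaves later copies of it that may not be overlined. If the first
    part is smaller, the bound drops to [m], a value not yet met, so overlining is free again. *)
Lemma bounded_op_cons m (free : bool) n a b s :
  bounded_op m.+1 free n ((a, b) :: s) =
  if a == m.+1 then [&& b ==> free, m < n & bounded_op m.+1 false (n - m.+1) s]
  else bounded_op m true n ((a, b) :: s).
Proof.
rewrite /bounded_op /=; case: (altP (a =P m.+1)) => [->|ne].
  rewrite leqnn /=; case: (ltnP m n) => h; last first.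
    by rewrite andbF (_ : _ == n = false) ?andbF //; apply/negbTE; lia.
  rewrite (_ : (m.+1 + sumn (op_parts s) == n) = (sumn (op_parts s) == n - m.+1)); last lia.
  case: free => /=; rewrite ?eqxx ?implybT ?implybF //=.
  by case: (all _ _); case: (path _ _ _); case: (_ == _); case: b; rewrite /= ?andbF ?andbT.
have -> : (a <= m.+1) = (a <= m) by lia.
case: free => //; case: b => //=.
have -> // : Some m.+1 != Some a.
by apply: contra_neq ne => -[->].
Qed.

Lemma mem_ovs f m free n s : m + n <= f ->
  (s \in ovs f m free n) = bounded_op m free n s.
Proof.
elim: f m free n s => [|f IH] [|m] free n s //= le_f.
- by rewrite bounded_op0; case: eqP => //= _; rewrite inE.
- by rewrite bounded_op0; case: eqP => //= _; rewrite inE.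
rewrite !mem_cat IH; last lia.
have memc b (t : seq (nat * bool)) (L : seq (seq (nat * bool))) :
    (t \in map (cons (m.+1, b)) L) =
    if t is x :: t' then (x == (m.+1, b)) && (t' \in L) else false.
  case: t => [|x t]; first by apply/mapP => -[].
  apply/mapP/andP => [[t' h [-> ->]] //|[/eqP -> h]]; by exists t.
have memL t : (t \in if m < n then ovs f m.+1 false (n - m.+1) else [::]) =
    (m < n) && bounded_op m.+1 false (n - m.+1) t.
  by case: ltnP => //= h; apply: IH; lia.
case: s => [|[a b] s].
  by rewrite memc; case: free; rewrite ?memc ?orbF.
rewrite bounded_op_cons memc memL xpair_eqE.
have -> : ((a, b) :: s \in (if free then [seq (m.+1, true) :: i
      | i <- if m < n then ovs f m.+1 false (n - m.+1) else [::]] else [::]))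
   = [&& free, a == m.+1, b & (m < n) && bounded_op m.+1 false (n - m.+1) s].
  by case: free; rewrite ?memc ?memL ?xpair_eqE //= eqb_id -andbA.
case: (altP (a =P m.+1)) => [->|ne] /=; last by rewrite andbF !orbF.
rewrite (_ : bounded_op m true n _ = false); last first.
  by rewrite /bounded_op /= ltnn /= andbF.
by case: b; case: free; rewrite /= ?orbF.
Qed.

Lemma uniq_ovs f m free n : m + n <= f -> uniq (ovs f m free n).
Proof.
elim: f m free n => [|f IH] [|m] free n //= le_f; try by case: ifP.
have uL : uniq (if m < n then ovs f m.+1 false (n - m.+1) else [::]).
  by case: ltnP => //= h; apply: IH; lia.
move: uL; set L := (if _ then _ else _) => uL.
have consI (b : bool) : injective (cons (m.+1, b)) by move=> ? ? [].
have um : uniq (ovs f m true n) by apply: IH; lia.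
rewrite !cat_uniq um map_inj_uniq // uL /=.
have dis (s : seq (nat * bool)) b : s \in map (cons (m.+1, b)) L ->
    s \notin ovs f m true n.
  case/mapP => t _ ->; rewrite mem_ovs; last lia.
  by rewrite /bounded_op /= ltnn /= andbF.
apply/and3P; split.
- apply/hasPn => s; rewrite mem_cat => /orP [|]; first exact: dis.
  by case: free => //; apply: dis.
- by case: free => //=; apply/hasPn => s /mapP [t _ ->]; apply/mapP => -[].
- by case: free => //; rewrite map_inj_uniq.
Qed.

Definition novs m free n := size (ovs (m + n) m free n).

Lemma size_ovs f m free n : m + n <= f -> size (ovs f m free n) = novs m free n.
Proof.
move=> le_f; apply/perm_size/uniq_perm; rewrite ?uniq_ovs // => s.
by rewrite !mem_ovs.
Qed.

Lemma novs0 free n : novs 0 free n = (n == 0).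
Proof. by rewrite /novs; case: n. Qed.

(** In generating functions, with x = q^(m+1): the unfree case multiplies by 1/(1 - x), the free
    case by 1 + 2x/(1 - x) = (1 + x)/(1 - x). *)
Lemma novsS m (free : bool) n : novs m.+1 free n =
  novs m true n + (1 + free) * (if m < n then novs m.+1 false (n - m.+1) else 0).
Proof.
rewrite {1}/novs addSn /= !size_cat size_map size_ovs ?leqnn //.
have -> : size (if m < n then ovs (m + n) m.+1 false (n - m.+1) else [::]) =
    if m < n then novs m.+1 false (n - m.+1) else 0.
  by case: ltnP => // h; rewrite size_ovs //; lia.
case: free; rewrite /= ?addn0 ?mul1n // size_map.
case: ltnP => // h; rewrite size_ovs; lia.
Qed.

Lemma sumn_ge (s : seq nat) a : a \in s -> a <= sumn s.
Proof.
elim: s => //= b s IH; rewrite inE => /orP [/eqP ->|/IH]; first exact: leq_addr.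
by move=> h; apply: leq_trans h (leq_addl _ _).
Qed.

Lemma size_le_sumn (s : seq nat) : all (fun a => 0 < a) s -> size s <= sumn s.
Proof. by elim: s => //= a s IH /andP [a0 /IH]; lia. Qed.

Lemma bounded_op_large m n s : n <= m ->
  bounded_op m true n s = is_overpartition n s.
Proof.
move=> le_nm; rewrite /bounded_op /is_overpartition; congr (_ && _).
case: (op_parts s) => //= a l; case: eqP => [E|]; last by rewrite !andbF.
by have -> : a <= m by lia.
Qed.

Lemma to_op_inj n : injective (@to_op n).
Proof.
move=> s t; rewrite /to_op => /inj_map e; apply/val_inj/e.
by move=> [x b] [y c] [] /= /ord_inj -> ->.
Qed.

Lemma pbar_novs m n : n <= m -> pbar n = novs m true n.
Proof.
move=> le_nm; rewrite /pbar /novs cardE -(size_map (@to_op n)).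
apply/perm_size/uniq_perm; rewrite ?uniq_ovs ?(map_inj_uniq (@to_op_inj n)) ?enum_uniq //.
move=> s; rewrite mem_ovs // bounded_op_large //; apply/mapP/idP => [[t + ->]|ov].
  by rewrite mem_enum.
have /and4P [pos _ /eqP sum _] := ov.
have szs : size s <= n by rewrite -sum -(size_map fst); apply: size_le_sumn.
(* [inord] alters no part here, since each part is at most the sum n. *)
pose g (x : nat * bool) := (inord x.1 : 'I_n.+1, x.2).
have szt : size (map g s) <= n by rewrite size_map.
have e : to_op (Bseq szt) = s.
  rewrite /to_op /= -map_comp -[RHS]map_id; apply/eq_in_map => -[a b] ab /=.
  by rewrite inordK // ltnS -sum; apply/sumn_ge/mapP; exists (a, b).
by exists (Bseq szt); rewrite // mem_enum inE e.
Qed.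

(** * Sums of three and four squares modulo 5 *)

(** Double counting of the pairs (u, x) with [c u x]: for fixed u, [g u] is a bijection from S onto
    the x in S' satisfying [c u]; for fixed x, the number of u is 1 modulo d. *)
Lemma mod_count_fibers (d : nat) (I T : eqType) (U : seq I) (S S' : seq T)
    (g : I -> T -> T) (c : I -> pred T) :
  uniq S -> uniq S' ->
  (forall u, u \in U -> injective (g u)) ->
  (forall u y, u \in U -> y \in S -> (g u y \in S') && c u (g u y)) ->
  (forall u x, u \in U -> x \in S' -> c u x -> exists2 y, y \in S & x = g u y) ->
  (forall x, x \in S' -> count (c^~ x) U = 1 %[mod d]) ->
  size U * size S = size S' %[mod d].
Proof.
move=> uS uS' gI gS gS' c1.
have -> : size U * size S = \sum_(u <- U) count (c u) S'.
  rewrite -sum1_size big_distrl /= !big_seq; apply: eq_bigr => u uU.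
  rewrite mul1n -size_filter -(size_map (g u)); apply/perm_size/uniq_perm.
  - by rewrite map_inj_uniq //; apply: gI.
  - exact: filter_uniq.
  move=> x; rewrite mem_filter; apply/mapP/andP => [[y yS ->]|[cx xS]].
    by have /andP [] := gS _ _ uU yS.
  exact: gS'.
have -> : \sum_(u <- U) count (c u) S' = \sum_(x <- S') count (c^~ x) U.
  under eq_bigr do rewrite -sum1_count big_mkcond.
  under [RHS]eq_bigr do rewrite -sum1_count big_mkcond.
  exact: exchange_big.
rewrite -[in RHS]sum1_size.
elim: S' c1 {uS' gS gS'} => [|x s IH] c1; first by rewrite !big_nil.
rewrite !big_cons -modnDm c1 ?mem_head // IH ?modnDm // => y ys.
by apply: c1; rewrite inE ys orbT.
Qed.

(** * Integer points in boxes and their norms *)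

Definition zball (M : nat) : seq Z :=
  0%Z :: map Z.of_nat (iota 1 M) ++ map (fun i => - Z.of_nat i)%Z (iota 1 M).

Lemma mem_zball M z : (z \in zball M) = (Z.abs_nat z <= M).
Proof.
rewrite inE mem_cat; apply/or3P/idP => [[/eqP -> //|/mapP [i]|/mapP [i]]|h];
  rewrite ?mem_iota; try lia.
case: (Z.lt_total z 0) => [z0|[->|z0]].
- apply: Or33; apply/mapP; exists (Z.abs_nat z); rewrite ?mem_iota; lia.
- exact: Or31.
- apply: Or32; apply/mapP; exists (Z.abs_nat z); rewrite ?mem_iota; lia.
Qed.

Lemma zball_uniq M : uniq (zball M).
Proof.
rewrite /zball /= mem_cat cat_uniq !map_inj_uniq ?iota_uniq; try by move=> ? ?; lia.
rewrite /= andbT; apply/andP; split.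
  by apply/norP; split; apply/mapP => -[i]; rewrite mem_iota; lia.
apply/hasPn => z /mapP [i]; rewrite mem_iota => h ->.
by apply/mapP => -[j]; rewrite mem_iota; lia.
Qed.

Definition zsq (z : Z) : nat := Z.abs_nat z ^ 2.
Definition wpair (T T' : Type) (w : T -> nat) (w' : T' -> nat) (p : T * T') :=
  w p.1 + w' p.2.
Definition prod_seq (T T' : Type) (L : seq T) (L' : seq T') :=
  [seq (x, y) | x <- L, y <- L'].

Notation Z2 := (Z * Z)%type.
Definition norm2 : Z2 -> nat := wpair zsq zsq.
Definition norm3 : Z2 * Z -> nat := wpair norm2 zsq.
Definition norm4 : Z2 * Z2 -> nat := wpair norm2 norm2.
Definition box2 M := prod_seq (zball M) (zball M).
Definition box3 M := prod_seq (box2 M) (zball M).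
Definition box4 M := prod_seq (box2 M) (box2 M).

Lemma zsqE z : Z.of_nat (zsq z) = (z * z)%Z.
Proof.
have := Nat2Z.inj_mul (Z.abs_nat z) (Z.abs_nat z).
by rewrite /zsq -mulnn multE; lia.
Qed.

Lemma mem_zsq_ball M z : zsq z <= M -> z \in zball M.
Proof.
rewrite mem_zball; apply: leq_trans.
by rewrite /zsq; case: (Z.abs_nat z) => // n; apply: (@leq_pexp2l _ 1).
Qed.

(** Since |z| <= z^2, a box of radius M misses no point of norm at most M, so counting in it gives
    the full number of representations. *)
Lemma norm3_box M p : norm3 p <= M -> p \in box3 M.
Proof.
case: p => [[a b] c]; rewrite /norm3 /wpair /norm2 /wpair /= => h.
by rewrite !allpairs_f //; apply: mem_zsq_ball; lia.
Qed.

Lemma norm4_box M p : norm4 p <= M -> p \in box4 M.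
Proof.
case: p => [[a b] [c d]]; rewrite /norm4 /wpair /norm2 /wpair /= => h.
by rewrite !allpairs_f //; apply: mem_zsq_ball; lia.
Qed.

Lemma prod_seq_uniq (T T' : eqType) (L : seq T) (L' : seq T') :
  uniq L -> uniq L' -> uniq (prod_seq L L').
Proof. by move=> uL uL'; apply: allpairs_uniq => // -[? ?] [? ?]. Qed.

(* The imaginary parts u of the six quaternions 1 + u of norm 5. *)
Definition imag_norm5 : seq (Z * Z * Z) :=
  [:: (2, 0, 0); (-2, 0, 0); (0, 2, 0); (0, -2, 0); (0, 0, 2); (0, 0, -2)]%Z.

(* Left multiplication of the quaternion a + b i + c j + d k by 1 + u. *)
Definition quat_mul (u : Z * Z * Z) (p : Z2 * Z2) : Z2 * Z2 :=
  let: (i, j, k) := u in let: ((a, b), (c, d)) := p in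
  ((a - i * b - j * c - k * d, b + i * a + j * d - k * c),
   (c + j * a + k * b - i * d, d + k * a + i * c - j * b))%Z.

(* The pure quaternion (1 + u) p (1 - u), simplified using |u|^2 = 4. *)
Definition quat_rot (u : Z * Z * Z) (p : Z2 * Z) : Z2 * Z :=
  let: (i, j, k) := u in let: ((x, y), z) := p in
  let s := (i * x + j * y + k * z)%Z in
  ((s * i * 2 + (j * z - k * y) * 2 - x * 3,
   s * j * 2 + (k * x - i * z) * 2 - y * 3),
   s * k * 2 + (i * y - j * x) * 2 - z * 3)%Z.

Definition quat_opp (u : Z * Z * Z) : Z * Z * Z :=
  let: (i, j, k) := u in (- i, - j, - k)%Z.

Ltac quat_unfold := cbv beta iota delta [quat_opp quat_mul quat_rot].

Definition div4 (m : Z) (p : Z2 * Z2) : bool :=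
  let: ((a, b), (c, d)) := p in
  [&& a mod m =? 0, b mod m =? 0, c mod m =? 0 & d mod m =? 0]%Z.
Definition div3 (m : Z) (p : Z2 * Z) : bool :=
  let: ((a, b), c) := p in [&& a mod m =? 0, b mod m =? 0 & c mod m =? 0]%Z.

(* [cond4 u] and [cond3 u] characterize the images of [quat_mul u] and
   [quat_rot u]: the inverses are [quat_mul (- u) / 5] and [quat_rot (- u) / 25]. *)
Definition cond4 u p := div4 5 (quat_mul (quat_opp u) p).
Definition cond3 u p := div3 25 (quat_rot (quat_opp u) p).

(** * Counting the quaternions that reach a given point *)

Definition residues (m : nat) : seq Z := map Z.of_nat (iota 0 m).

Lemma mem_residues (m : nat) (z : Z) : 0 < m -> (z mod Z.of_nat m)%Z \in residues m.
Proof.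
move=> m0; have h := Z.mod_pos_bound z (Z.of_nat m) ltac:(lia).
apply/mapP; exists (Z.to_nat (z mod Z.of_nat m)); rewrite ?mem_iota; lia.
Qed.

Definition one_or_six n := (n == 1) || (n == 6).

Lemma cond4_count_residues : all (fun a => all (fun b => all (fun c => all (fun d =>
   ((a * a + b * b + c * c + d * d) mod 5 =? 0)%Z ==>
   one_or_six (count (cond4^~ ((a, b), (c, d))) imag_norm5))
   (residues 5)) (residues 5)) (residues 5)) (residues 5).
Proof. by vm_compute. Qed.

(** A norm modulo 125 is not determined by residues modulo 25, except when all coordinates are
    divisible by 5. In that case divisibility of the norm by 25 is automatic, and the premise asks
    for 125 instead. *)
Lemma cond3_count_residues : all (fun a => all (fun b => all (fun c =>
   [&& (a * a + b * b + c * c) mod 25 =? 0 &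
     (div3 5 ((a, b), c) ==> ((a * a + b * b + c * c) mod 125 =? 0))]%Z ==>
   one_or_six (count (cond3^~ ((a, b), c)) imag_norm5))
   (residues 25)) (residues 25)) (residues 25).
Proof. by vm_compute. Qed.

Lemma one_or_six_mod5 n : one_or_six n -> n = 1 %[mod 5].
Proof. by case/orP => /eqP ->. Qed.

Lemma split_residue (m : nat) (z : Z) : 0 < m ->
  exists q r, r \in residues m /\ z = (r + q * Z.of_nat m)%Z.
Proof.
move=> m0; exists (z / Z.of_nat m)%Z, (z mod Z.of_nat m)%Z; split.
  exact: mem_residues.
by rewrite Z.add_comm (Z.mul_comm (_ / _)%Z); apply: Z.div_mod; case: m m0.
Qed.

Lemma eqb_mod_add (m q x y : Z) : x = (y + q * m)%Z ->
  (x mod m =? 0)%Z = (y mod m =? 0)%Z.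
Proof. by move=> ->; rewrite Z_mod_plus_full. Qed.

Lemma cond4_count a b c d : ((a * a + b * b + c * c + d * d) mod 5 = 0)%Z ->
  count (cond4^~ ((a, b), (c, d))) imag_norm5 = 1 %[mod 5].
Proof.
have [qa [ra [ha ->]]] := split_residue a (isT : 0 < 5).
have [qb [rb [hb ->]]] := split_residue b (isT : 0 < 5).
have [qc [rc [hc ->]]] := split_residue c (isT : 0 < 5).
have [qd [rd [hd ->]]] := split_residue d (isT : 0 < 5).
have -> : Z.of_nat 5 = 5%Z by [].
move=> h; apply: one_or_six_mod5.
have /implyP := allP (allP (allP (allP cond4_count_residues _ ha) _ hb) _ hc) _ hd.
have -> : ((ra * ra + rb * rb + rc * rc + rd * rd) mod 5 =? 0)%Z.
  move/Z.eqb_eq: h; rewrite (@eqb_mod_add _ (2 * ra * qa + 5 * qa * qa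
    + 2 * rb * qb + 5 * qb * qb + 2 * rc * qc + 5 * qc * qc
    + 2 * rd * qd + 5 * qd * qd) _ (ra * ra + rb * rb + rc * rc + rd * rd)%Z) //.
  by ring.
move=> /(_ isT); congr (is_true (one_or_six _)).
apply: eq_count => -[[i j] k]; rewrite /cond4 /quat_opp /quat_mul /div4.
(* By linearity, passing from the residues to the point adds 5 times the coordinates of [q]. *)
pose q := quat_mul (-i, -j, -k)%Z ((qa, qb), (qc, qd)).
by congr [&& _, _, _ & _]; symmetry;
  [apply: (@eqb_mod_add _ q.1.1) | apply: (@eqb_mod_add _ q.1.2)
  |apply: (@eqb_mod_add _ q.2.1) | apply: (@eqb_mod_add _ q.2.2)];
  rewrite /q /quat_mul; cbv beta iota zeta delta [fst snd]; ring.
Qed.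

Lemma cond3_count x y z : ((x * x + y * y + z * z) mod 125 = 0)%Z ->
  count (cond3^~ ((x, y), z)) imag_norm5 = 1 %[mod 5].
Proof.
have [qx [rx [hx ->]]] := split_residue x (isT : 0 < 25).
have [qy [ry [hy ->]]] := split_residue y (isT : 0 < 25).
have [qz [rz [hz ->]]] := split_residue z (isT : 0 < 25).
have -> : Z.of_nat 25 = 25%Z by [].
set s := (X in (X mod 125)%Z) => /Z.mod_divide -/(_ ltac:(lia)) [t st].
apply: one_or_six_mod5.
have /implyP := allP (allP (allP cond3_count_residues _ hx) _ hy) _ hz.
have -> : ((rx * rx + ry * ry + rz * rz) mod 25 =? 0)%Z.
  apply/Z.eqb_eq/Z.mod_divide; first by lia.
  exists (5 * t - (2 * rx * qx + 25 * qx * qx + 2 * ry * qy + 25 * qy * qy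
    + 2 * rz * qz + 25 * qz * qz))%Z.
  by move: st; rewrite /s; lia.
(* When r = 5u, the difference (r + 25q)^2 - r^2 = 250uq + 625q^2 is a multiple of 125, so the
   residues inherit the divisibility. *)
have -> : div3 5 (rx, ry, rz) ==>
    ((rx * rx + ry * ry + rz * rz) mod 125 =? 0)%Z.
  apply/implyP => /and3P [] /Z.eqb_eq /Z.mod_divide -/(_ ltac:(lia)) [ux ex]
    /Z.eqb_eq /Z.mod_divide -/(_ ltac:(lia)) [uy ey]
    /Z.eqb_eq /Z.mod_divide -/(_ ltac:(lia)) [uz ez].
  apply/Z.eqb_eq/Z.mod_divide; first by lia.
  exists (t - (2 * ux * qx + 5 * qx * qx + 2 * uy * qy + 5 * qy * qy
    + 2 * uz * qz + 5 * qz * qz))%Z.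
  by move: st; rewrite /s ex ey ez; lia.
move=> /(_ isT); congr (is_true (one_or_six _)).
apply: eq_count => -[[i j] k]; rewrite /cond3 /quat_opp /quat_rot /div3.
pose q := quat_rot (-i, -j, -k)%Z ((qx, qy), qz).
by congr [&& _, _ & _]; symmetry;
  [apply: (@eqb_mod_add _ q.1.1) | apply: (@eqb_mod_add _ q.1.2)
  |apply: (@eqb_mod_add _ q.2)]; rewrite /q /quat_rot; cbv beta iota zeta delta [fst snd]; ring.
Qed.

(** * Inverses of the quaternion maps and their effect on norms *)

(** This is (1 - u)(1 + u) = 1 + |u|^2 = 5. *)
Lemma quat_mulK (u : Z * Z * Z) a b c d : u \in imag_norm5 ->
  quat_mul (quat_opp u) (quat_mul u ((a, b), (c, d))) = ((a * 5, b * 5), (c * 5, d * 5))%Z.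
Proof.
rewrite !inE.
by move=> /or4P [/eqP|/eqP|/eqP|/or3P [/eqP|/eqP|/eqP]] ->; quat_unfold;
  congr ((_, _), (_, _)); ring.
Qed.

Lemma quat_rotK (u : Z * Z * Z) x y z : u \in imag_norm5 ->
  quat_rot (quat_opp u) (quat_rot u ((x, y), z)) = ((x * 25, y * 25), z * 25)%Z.
Proof.
rewrite !inE.
by move=> /or4P [/eqP|/eqP|/eqP|/or3P [/eqP|/eqP|/eqP]] ->; quat_unfold;
  congr ((_, _), _); ring.
Qed.

Lemma quat_oppK : involutive quat_opp.
Proof. by case=> [[i j] k] /=; congr (_, _, _); lia. Qed.

Lemma quat_opp_norm5 u : u \in imag_norm5 -> quat_opp u \in imag_norm5.
Proof.
rewrite !inE.
by move=> /or4P [/eqP|/eqP|/eqP|/or3P [/eqP|/eqP|/eqP]] ->.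
Qed.

Lemma quat_mulKV u p : u \in imag_norm5 -> cond4 u p ->
  exists y, p = quat_mul u y.
Proof.
move=> uU; case E: (quat_mul (quat_opp u) p) => [[a b] [c d]].
rewrite /cond4 E => /and4P [/Z.eqb_eq/Z.mod_divide -/(_ ltac:(lia)) [a' ea]
  /Z.eqb_eq/Z.mod_divide -/(_ ltac:(lia)) [b' eb]
  /Z.eqb_eq/Z.mod_divide -/(_ ltac:(lia)) [c' ec]
  /Z.eqb_eq/Z.mod_divide -/(_ ltac:(lia)) [d' ed]].
exists ((a', b'), (c', d')).
case: p E => [[pa pb] [pc pd]] E.
(* With (1 - u) p = 5y, multiplying by 1 + u gives 5p = 5 (1 + u) y, and the factor 5 cancels. *)
have := quat_mulK pa pb pc pd (quat_opp_norm5 uU); rewrite quat_oppK E.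
rewrite ea eb ec ed; case: u {E uU} => [[i j] k]; quat_unfold => -[].
move=> *; congr ((_, _), (_, _)); lia.
Qed.

Lemma quat_rotKV u p : u \in imag_norm5 -> cond3 u p ->
  exists y, p = quat_rot u y.
Proof.
move=> uU; case E: (quat_rot (quat_opp u) p) => [[a b] c].
rewrite /cond3 E => /and3P [/Z.eqb_eq/Z.mod_divide -/(_ ltac:(lia)) [a' ea]
  /Z.eqb_eq/Z.mod_divide -/(_ ltac:(lia)) [b' eb]
  /Z.eqb_eq/Z.mod_divide -/(_ ltac:(lia)) [c' ec]].
exists ((a', b'), c').
case: p E => [[pa pb] pc] E.
have := quat_rotK pa pb pc (quat_opp_norm5 uU); rewrite quat_oppK E.
rewrite ea eb ec; case: u {E uU} => [[i j] k]; quat_unfold => -[].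
move=> *; congr ((_, _), _); lia.
Qed.

Lemma quat_mul_inj u : u \in imag_norm5 -> injective (quat_mul u).
Proof.
move=> uU [[a b] [c d]] [[a' b'] [c' d']] /(congr1 (quat_mul (quat_opp u))).
by rewrite !quat_mulK // => -[*]; congr ((_, _), (_, _)); lia.
Qed.

Lemma quat_rot_inj u : u \in imag_norm5 -> injective (quat_rot u).
Proof.
move=> uU [[a b] c] [[a' b'] c'] /(congr1 (quat_rot (quat_opp u))).
by rewrite !quat_rotK // => -[*]; congr ((_, _), _); lia.
Qed.

Lemma norm4E a b c d : Z.of_nat (norm4 ((a, b), (c, d))) = (a * a + b * b + c * c + d * d)%Z.
Proof. by rewrite /norm4 /norm2 /wpair /= !Nat2Z.inj_add !zsqE; ring. Qed.

Lemma norm3E a b c : Z.of_nat (norm3 ((a, b), c)) = (a * a + b * b + c * c)%Z.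
Proof. by rewrite /norm3 /norm2 /wpair /= !Nat2Z.inj_add !zsqE; ring. Qed.

Lemma norm4_quat_mul u p : u \in imag_norm5 -> norm4 (quat_mul u p) = 5 * norm4 p.
Proof.
case: p => [[a b] [c d]] uU; apply: Nat2Z.inj; rewrite Nat2Z.inj_mul norm4E.
move: uU; rewrite !inE.
by move=> /or4P [/eqP|/eqP|/eqP|/or3P [/eqP|/eqP|/eqP]] ->; quat_unfold; rewrite norm4E; ring.
Qed.

Lemma norm3_quat_rot u p : u \in imag_norm5 -> norm3 (quat_rot u p) = 25 * norm3 p.
Proof.
case: p => [[a b] c] uU; apply: Nat2Z.inj; rewrite Nat2Z.inj_mul norm3E.
move: uU; rewrite !inE.
by move=> /or4P [/eqP|/eqP|/eqP|/or3P [/eqP|/eqP|/eqP]] ->; quat_unfold; rewrite norm3E; ring.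
Qed.

(** * Representation numbers modulo 5 *)

Definition rep4 M n := count (fun p => norm4 p == n) (box4 M).
Definition rep3 M n := count (fun p => norm3 p == n) (box3 M).

Lemma rep4_mod5 M n : 5 * n <= M -> rep4 M (5 * n) = rep4 M n %[mod 5].
Proof.
move=> le_M; rewrite /rep4 -!size_filter.
have uB : uniq (box4 M) by rewrite !prod_seq_uniq // zball_uniq.
symmetry.
have := @mod_count_fibers 5 _ _ imag_norm5 [seq p <- box4 M | norm4 p == n]
  [seq p <- box4 M | norm4 p == 5 * n] quat_mul cond4.
rewrite !filter_uniq // => /(_ isT isT quat_mul_inj) h; rewrite -{}h //.
- by move: (size _) => m; rewrite (mulnDl 5 1 m) -modnDml modnMr mul1n.
- move=> u [[a b] [c d]] uU; rewrite !mem_filter => /andP [/eqP E _].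
  rewrite norm4_quat_mul // E eqxx norm4_box ?norm4_quat_mul ?E //=.
  by rewrite /cond4 quat_mulK // /div4 !Z_mod_mult.
- move=> u x uU; rewrite mem_filter => /andP [/eqP E _] /(quat_mulKV uU) [y ey].
  have wy : norm4 y = n by move: E; rewrite ey norm4_quat_mul //; lia.
  by exists y => //; rewrite mem_filter wy eqxx norm4_box // wy; lia.
- move=> [[a b] [c d]]; rewrite mem_filter => /andP [/eqP E _].
  by apply: cond4_count; rewrite -norm4E E Nat2Z.inj_mul Z.mul_comm Z_mod_mult.
Qed.

(** Six rotations multiply the norm by 25, and 6 = 1 modulo 5. Starting from norm 5n makes the
    target norm divisible by 125, as [cond3_count] demands. *)
Lemma rep3_mod5 M n : 125 * n <= M -> rep3 M (125 * n) = rep3 M (5 * n) %[mod 5].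
Proof.
move=> le_M; rewrite /rep3 -!size_filter.
have uB : uniq (box3 M) by rewrite !prod_seq_uniq // zball_uniq.
symmetry.
have := @mod_count_fibers 5 _ _ imag_norm5 [seq p <- box3 M | norm3 p == 5 * n]
  [seq p <- box3 M | norm3 p == 125 * n] quat_rot cond3.
rewrite !filter_uniq // => /(_ isT isT quat_rot_inj) h; rewrite -{}h //.
- by move: (size _) => m; rewrite (mulnDl 5 1 m) -modnDml modnMr mul1n.
- move=> u [[a b] c] uU; rewrite !mem_filter => /andP [/eqP E _].
  rewrite norm3_quat_rot // E (mulnA 25 5) eqxx norm3_box ?norm3_quat_rot ?E ?mulnA //=.
  by rewrite /cond3 quat_rotK // /div3 !Z_mod_mult.
- move=> u x uU; rewrite mem_filter => /andP [/eqP E _] /(quat_rotKV uU) [y ey].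
  have wy : norm3 y = 5 * n by move: E; rewrite ey norm3_quat_rot //; lia.
  by exists y => //; rewrite mem_filter wy eqxx norm3_box // wy; lia.
- move=> [[a b] c]; rewrite mem_filter => /andP [/eqP E _].
  by apply: cond3_count; rewrite -norm3E E Nat2Z.inj_mul Z.mul_comm Z_mod_mult.
Qed.

From mathcomp Require Import all_algebra finfield ring.
Import GRing.Theory.

(** * A finite form of Gauss' identity *)

Section PowerSeries.
Local Open Scope ring_scope.

Section FiniteGauss.
Variables (R : comNzRingType) (q : R).

(** In q-Pochhammer notation [poch_plus n] is (-q; q)_n, and [poch_minus s n] is (q; q)_n / (q; q)_s
    for s <= n. *)
Definition poch_plus n : R := \prod_(k < n) (1 + q ^+ k.+1).
Definition poch_minus s n : R := \prod_(s <= k < n) (1 - q ^+ k.+1).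
Definition gauss_sum n : R :=
  1 + \sum_(1 <= j < n.+1) 2%:R * (-1) ^+ j * q ^+ (j ^ 2).

Lemma poch_plusS n : poch_plus n.+1 = poch_plus n * (1 + q ^+ n.+1).
Proof. exact: big_ord_recr. Qed.

Lemma poch_minusS s n : (s <= n)%N ->
  poch_minus s n.+1 = poch_minus s n * (1 - q ^+ n.+1).
Proof. exact: big_nat_recr. Qed.

Lemma poch_minus_ltn s n : (s < n)%N ->
  poch_minus s n = (1 - q ^+ s.+1) * poch_minus s.+1 n.
Proof. exact: big_ltn. Qed.

Lemma poch_minus_id n : poch_minus n n = 1.
Proof. by rewrite /poch_minus big_geq. Qed.

Lemma gauss_sumS n :
  gauss_sum n.+1 = gauss_sum n + 2%:R * (-1) ^+ n.+1 * q ^+ (n.+1 ^ 2).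
Proof. by rewrite /gauss_sum big_nat_recr //= addrA. Qed.

(* Summing over [s], these are the error terms by which the truncated Gauss sum
   fails to be the quotient of the two products; each has order above [n]. *)
Definition gauss_term n s : R :=
  (-1) ^+ s.+1 * q ^+ (s.+1 * n.+1) * poch_plus s * poch_minus s.+1 n.

(* The right-hand side has the form h (s + 1) - h s, so it telescopes. *)
Lemma gauss_term_diff n s : (s < n)%N ->
  gauss_term n.+1 s - (1 + q ^+ n.+1) * gauss_term n s =
  (-1) ^+ s.+2 * q ^+ (s.+2 * n.+1) * poch_plus s.+1 * poch_minus s.+1 n
  - (-1) ^+ s.+1 * q ^+ (s.+1 * n.+1) * poch_plus s * poch_minus s n.
Proof.
move=> lt_sn; rewrite /gauss_term poch_minusS // (poch_minus_ltn lt_sn) poch_plusS.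
rewrite (mulnS s.+1 n.+1) (mulSn s.+1) !exprD !(exprS _ s.+1).
ring.
Qed.

Lemma finite_gauss n : poch_plus n * gauss_sum n =
  poch_minus 0 n + 2%:R * \sum_(s < n) gauss_term n s.
Proof.
elim: n => [|n IH].
  by rewrite /poch_plus /gauss_sum /poch_minus !big_ord0 !big_geq // mulr0 !addr0 mulr1.
(* Of the two boundary terms, the first joins [gauss_term n.+1 n] to give the new square term; the
   second, doubled, turns 1 - q^(n+1) into 1 + q^(n+1). *)
have tel : \sum_(s < n) (gauss_term n.+1 s - (1 + q ^+ n.+1) * gauss_term n s) =
    (-1) ^+ n.+1 * q ^+ (n.+1 * n.+1) * poch_plus n
    + q ^+ n.+1 * poch_minus 0 n.
  pose h s := (-1) ^+ s.+1 * q ^+ (s.+1 * n.+1) * poch_plus s * poch_minus s n.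
  rewrite (eq_bigr (fun s : 'I_n => h s.+1 - h s)); last first.
    by move=> s _; rewrite gauss_term_diff.
  rewrite -(big_mkord xpredT (fun s => h s.+1 - h s)) telescope_sumr //.
  rewrite /h poch_minus_id mul1n /poch_plus big_ord0; ring.
have -> : \sum_(s < n.+1) gauss_term n.+1 s =
    (1 + q ^+ n.+1) * \sum_(s < n) gauss_term n s
    + ((-1) ^+ n.+1 * q ^+ (n.+1 * n.+1) * poch_plus n
      + q ^+ n.+1 * poch_minus 0 n) + gauss_term n.+1 n.
  by rewrite big_ord_recr /= -tel sumrB mulr_sumr; ring.
rewrite poch_plusS gauss_sumS mulrDr mulrAC IH.
rewrite poch_minusS // /gauss_term poch_minus_id -mulnn.
rewrite (mulnS n.+1 n.+1) !exprD.
ring.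
Qed.
End FiniteGauss.

(** * Polynomials as power series truncated at order N *)

Section Truncation.
Variable F : fieldType.
Implicit Types p q r : {poly F}.

Definition eqX (N : nat) p q := 'X^N %| p - q.

Lemma dvdXnP (N : nat) p : reflect (forall i, (i < N)%N -> p`_i = 0) ('X^N %| p).
Proof.
apply: (iffP idP) => [/dvdpP [r ->] i lt_iN|h]; first by rewrite coefMXn lt_iN.
apply/dvdpP; exists (drop_poly N p).
rewrite -[LHS](poly_take_drop N) -[RHS]add0r; congr (_ + _).
apply/polyP => i; rewrite coef_take_poly coef0; case: ifP => //; exact: h.
Qed.

Lemma eqXP N p q : reflect (forall i, (i < N)%N -> p`_i = q`_i) (eqX N p q).
Proof.
apply: (iffP (dvdXnP _ _)) => h i /h; rewrite coefB; last by move->; rewrite subrr.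
by move/eqP; rewrite subr_eq0 => /eqP.
Qed.

Lemma eqX_trans N p q r : eqX N p q -> eqX N q r -> eqX N p r.
Proof. by rewrite /eqX => h1 h2; rewrite -(subrKA q) dvdp_add. Qed.

Lemma eqX_mull N p q r : eqX N p q -> eqX N (r * p) (r * q).
Proof. by rewrite /eqX -mulrBr; apply: dvdp_mull. Qed.

(** A polynomial with constant term 1 is coprime to X^N. *)
Lemma eqX_cancel N p q r : r`_0 = 1 -> eqX N (r * p) (r * q) -> eqX N p q.
Proof.
move=> r0; have co : coprimep 'X^N r.
  by rewrite coprimep_expl // coprimep_sym coprimepX /root horner_coef0 r0 oner_eq0.
by rewrite /eqX -mulrBr Gauss_dvdpr.
Qed.
End Truncation.

(** * Overpartitions modulo 5 *)

Section OverpartitionSeries.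
Variable F : fieldType.

Definition novs_poly N m free : {poly F} := \poly_(i < N) (novs m free i)%:R.

Lemma novs_polyS_false N m :
  eqX N ((1 - 'X^(m.+1)) * novs_poly N m.+1 false) (novs_poly N m true).
Proof.
apply/eqXP => i lt_iN; rewrite mulrBl mul1r coefB coefXnM !coef_poly lt_iN.
rewrite novsS mul1n natrD (leq_ltn_trans (leq_subr _ _) lt_iN) ltnNge if_neg ltnS.
by case: ifP => _; rewrite ?subr0 ?addr0 // addrK.
Qed.

Lemma novs_polyS_true N m : eqX N (novs_poly N m.+1 true)
  (novs_poly N m true + 2%:R * ('X^(m.+1) * novs_poly N m.+1 false)).
Proof.
apply/eqXP => i lt_iN; rewrite mulr_natl coefD coefMn coefXnM !coef_poly lt_iN.
rewrite novsS natrD natrM mulr_natl (leq_ltn_trans (leq_subr _ _) lt_iN).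
by rewrite ltnNge ltnS; case: leqP.
Qed.

(** The product of (1 + X^k)/(1 - X^k) over k <= m, with denominators cleared. *)
Lemma novs_poly_poch N m :
  eqX N (novs_poly N m true * poch_minus 'X 0 m) (poch_plus 'X m).
Proof.
elim: m => [|m IH].
  rewrite poch_minus_id mulr1 /poch_plus big_ord0; apply/eqXP => i lt_iN.
  by rewrite coef_poly lt_iN novs0 coef1.
rewrite poch_minusS // poch_plusS.
have h1 := novs_polyS_true N m; have h2 := novs_polyS_false N m.
move: IH h1 h2; rewrite /eqX.
set g := novs_poly N m true; set g1 := novs_poly _ _ true.
set g2 := novs_poly _ _ false; set a := poch_minus _ _ _; set b := poch_plus _ _.
move=> h0 h1 h2.
(* The goal is a combination of the induction hypothesis and the two recurrences. *)
have -> : g1 * (a * (1 - 'X^(m.+1))) - b * (1 + 'X^(m.+1)) =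
  (1 + 'X^(m.+1)) * (g * a - b)
  + a * (1 - 'X^(m.+1)) * (g1 - (g + 2%:R * ('X^(m.+1) * g2)))
  + 2%:R * a * 'X^(m.+1) * ((1 - 'X^(m.+1)) * g2 - g) by ring.
by rewrite !dvdp_add ?dvdp_mull.
Qed.

Definition pbar_poly N : {poly F} := \poly_(i < N) (pbar i)%:R.

Lemma coef0_poch_plus n : (poch_plus 'X n : {poly F})`_0 = 1.
Proof.
elim: n => [|n IH]; first by rewrite /poch_plus big_ord0 coef1.
by rewrite poch_plusS coef0M IH mul1r coefD coef1 coefXn addr0.
Qed.

Lemma pbar_poly_gauss N : eqX N (pbar_poly N * gauss_sum 'X N) 1.
Proof.
apply: (eqX_cancel (coef0_poch_plus N)); rewrite mulr1.
have h : eqX N (poch_plus 'X N * gauss_sum 'X N) (poch_minus 'X 0 N : {poly F}).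
  rewrite finite_gauss /eqX addrAC subrr add0r dvdp_mull //.
  apply: (big_ind (fun p => 'X^N %| p)) => [||s _]; [exact: dvdp0|exact: dvdp_add|].
  (* The power of X in the term is (s + 1)(N + 1) >= N. *)
  rewrite /gauss_term dvdp_mulr // dvdp_mulr // dvdp_mull // dvdp_exp2l //.
  by rewrite mulSn mulnS; lia.
rewrite mulrCA; apply: eqX_trans (eqX_mull _ h) _.
have -> : pbar_poly N = novs_poly N N true.
  apply/polyP => i; rewrite !coef_poly; case: ltnP => // lt_iN.
  by rewrite (pbar_novs (ltnW lt_iN)).
exact: novs_poly_poch.
Qed.

(* The sign (-1)^(w p) is carried by the variable - 'X. *)
Definition theta_seq (T : Type) (L : seq T) (w : T -> nat) : {poly F} :=
  \sum_(p <- L) (- 'X) ^+ w p.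

Lemma theta_prod (T T' : Type) (L : seq T) (L' : seq T') w w' :
  theta_seq (prod_seq L L') (wpair w w') = theta_seq L w * theta_seq L' w'.
Proof.
rewrite /theta_seq /prod_seq big_allpairs_dep big_distrl /=; apply: eq_bigr => x _.
by rewrite big_distrr /=; apply: eq_bigr => y _; rewrite -exprD.
Qed.

Lemma coef_theta (T : Type) (L : seq T) w n :
  (theta_seq L w)`_n = (-1) ^+ n * (count (fun p => w p == n) L)%:R.
Proof.
rewrite /theta_seq coef_sum -sum1_count natr_sum mulr_sumr [RHS]big_mkcond.
apply: eq_bigr => p _; rewrite -scaleN1r exprZn coefZ coefXn eq_sym.
by case: eqP => [->|_]; rewrite ?mulr0.
Qed.

Lemma gauss_sum_theta M : gauss_sum 'X M = theta_seq (zball M) zsq.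
Proof.
rewrite /gauss_sum /theta_seq /zball big_cons big_cat !big_map /= expr0; congr (_ + _).
rewrite -big_split /index_iota subn1 /=; apply: eq_bigr => i _.
(* The square i^2 has the parity of i; the two values z = i and z = -i produce the coefficient 2. *)
have e z : Z.abs_nat z = i -> (- 'X : {poly F}) ^+ zsq z = (-1) ^+ i * 'X^(i ^ 2).
  by move=> zi; rewrite /zsq zi (exprNn 'X) -signr_odd oddX signr_odd.
by rewrite !e; [ring | lia | lia].
Qed.
End OverpartitionSeries.

(** * Frobenius and extraction of exponents divisible by 5 *)

Lemma natr_F5 (a b : nat) : (a%:R == b%:R :> 'F_5) = (a == b %[mod 5]).
Proof. by rewrite -val_eqE /= !val_Fp_nat. Qed.

Lemma frobenius5 (p : {poly 'F_5}) : p ^+ 5 = p \Po 'X^5.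
Proof.
have ch : 5%N \in [pchar {poly 'F_5}] by rewrite pchar_poly pchar_Fp.
elim/poly_ind: p => [|p c IH]; first by rewrite comp_poly0 expr0n.
rewrite -(pFrobenius_autE ch) rmorphD rmorphM /= !pFrobenius_autE IH.
rewrite comp_polyD comp_polyM comp_polyX comp_polyC -polyC_exp.
by congr (_ + _%:P); rewrite -[RHS]expf_card card_Fp.
Qed.

(** Only exponents divisible by d occur in q(X^d), so they pair only with such exponents of p, which
    P collects up to order n. *)
Lemma coef_mul_comp_Xn (R : comNzRingType) (d : nat) (p q P : {poly R}) (n : nat) :
  (0 < d)%N -> (forall j, (j <= n)%N -> P`_j = p`_(d * j)) ->
  (p * (q \Po 'X^d))`_(d * n) = (P * q)`_n.
Proof.
move=> d0 Pp; rewrite comp_polyE mulr_sumr coef_sum.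
rewrite -[in RHS](coefK q) poly_def mulr_sumr coef_sum; apply: eq_bigr => j _.
rewrite -!scalerAr !coefZ -exprM !coefMXn ltn_pmul2l //.
by case: ltnP => // le_jn; rewrite -mulnBr Pp // leq_subr.
Qed.

Lemma pbar_rep3 n M : (5 * n < M)%N ->
  (pbar (5 * n))%:R = (-1) ^+ n * (rep3 M n)%:R :> 'F_5.
Proof.
move=> lt_nM; pose phi : {poly 'F_5} := gauss_sum 'X M.
pose P := pbar_poly 'F_5 M.
pose Q : {poly 'F_5} := \poly_(i < n.+1) (pbar (5 * i))%:R.
have phi3 : phi ^+ 3 = theta_seq _ (box3 M) norm3.
  by rewrite !theta_prod -!gauss_sum_theta -/phi !exprS expr0 mulr1 ?mulrA.
have phi4 : phi ^+ 4 = theta_seq _ (box4 M) norm4.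
  by rewrite !theta_prod -!gauss_sum_theta -/phi !exprS expr0 mulr1 ?mulrA.
have hP : eqX M (P * phi ^+ 5) (phi ^+ 4).
  have := eqX_mull (phi ^+ 4) (pbar_poly_gauss 'F_5 M).
  by rewrite mulr1 mulrCA -exprSr.
(* Coefficient i of [phi * Q] is coefficient 5i of [P * phi ^+ 5], hence of [phi ^+ 4]. By
   [rep4_mod5] and the equal parity of 5i and i, it equals coefficient i of [phi ^+ 4]. *)
have hQ : eqX n.+1 (phi * Q) (phi * phi ^+ 3).
  apply/eqXP => i; rewrite ltnS => le_in; rewrite -exprS mulrC.
  rewrite -(@coef_mul_comp_Xn _ 5 P) //; last first.
    by move=> j le_ji; rewrite !coef_poly !ifT //; lia.
  rewrite -frobenius5 (eqXP _ _ _ hP); last by lia.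
  rewrite phi4 !coef_theta -signr_odd oddM signr_odd; congr (_ * _).
  by apply/eqP; rewrite natr_F5; apply/eqP/rep4_mod5; lia.
have phi0 : phi`_0 = 1.
  rewrite /phi /gauss_sum coefD coef1 coef_sum big_nat big1 ?addr0 // => j /andP [j0 _].
  by rewrite coefMXn expn_gt0 j0.
have := eqXP _ _ _ (eqX_cancel phi0 hQ) n (ltnSn n).
by rewrite phi3 coef_theta coef_poly ltnSn.
Qed.

End PowerSeries.

Theorem theorem1p5 (n : nat) : pbar (5 ^ 2 * n) = pbar (5 ^ 4 * n) %[mod 5].
(* The bound M exceeds both indices 25n and 625n, so one box serves both sides. *)
Proof.
pose M := (625 * n).+1.
apply/eqP; rewrite -natr_F5.
rewrite (_ : 5 ^ 2 * n = 5 * (5 * n))%N; last by rewrite mulnA.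
rewrite (_ : 5 ^ 4 * n = 5 * (125 * n))%N; last by rewrite mulnA.
rewrite !(@pbar_rep3 _ M) /M; try lia.
(* Both signs (-1)^(5n) and (-1)^(125n) equal (-1)^n. *)
rewrite -signr_odd oddM signr_odd -[in X in _ == X]signr_odd oddM signr_odd.
apply/eqP; congr (_ * _)%R; apply/eqP; rewrite natr_F5 eq_sym.
by apply/eqP/rep3_mod5; lia.
Qed.
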